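(* Let $\alpha,\alpha'$ be two admissible assignings of a graph $G$. If $\alpha(C)\le \alpha'(C)$ for all cycles $C\in \mathcal{C}(G)$, then the unsigned coefficients of the cycle-assigning polynomials $P(G,\alpha;k)$ and $P(G,\alpha';k)$ satisfy \[ w_i(G,\alpha)\le w_i(G,\alpha') \quad \mbox{ for }\quad i=0,1,\ldots,r(G). \] In particular, $w_i(G)=w_i(G,0)\le w_i(G,\alpha)$ for any admissible assigning $\alpha$ of $G$, where $w_i(G)$ are the unsigned coefficients of the chromatic polynomial of $G$ and $0$ denotes the assigning that is identically zero.
   Context: Graphs are finite and may have loops and multiple edges; Abelian groups $A$ are additive and finite; $D$ is a fixed orientation of $G$. A cycle of $G$ is a connected 2-regular subgraph (a loop with its vertex is a cycle with one edge; two parallel edges form a cycle); $\mathcal{C}(G)$ is the set of cycles. An assigning of $G$ is a map $\alpha:\mathcal{C}(G)\to\{0,1\}$. For each cycle $C$ fix one of its two directions $o(C)$ and define $\eta_{D(C)}:E(G)\to\{0,\pm1\}$ by $\eta_{D(C)}(e)=1$ if $e\in E(C)$ and the direction of $e$ under $D$ is consistent with $o(C)$, $-1$ if $e\in E(C)$ and the direction of $e$ is opposite to $o(C)$, and $0$ if $e\notin E(C)$. For $f:E(G)\to A$, set $\alpha_{D,f}(C)=0$ if $\sum_{e\in E(C)}\eta_{D(C)}(e)f(e)=0$ and $1$ otherwise. An assigning $\alpha$ is admissible if $\alpha=\alpha_{D,f}$ for some finite Abelian group $A$ and some $f:E(G)\to A$ (independent of $D$ and the $o(C)$). A subgraph $H$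 of $G$ is $\alpha$-compatible if $\alpha(C)=0$ for every cycle $C$ of $H$. The cycle-assigning polynomial is $P(G,\alpha;k):=\sum_{H}(-1)^{|E(H)|}k^{c(H)}$, the sum over all $\alpha$-compatible spanning subgraphs $H$ of $G$ (spanning: $V(H)=V(G)$), where $c(H)$ is the number of components of $H$. With $r(G)=|V(G)|-c(G)$, the unsigned coefficients $w_i(G,\alpha)$ are defined by $P(G,\alpha;k)=\sum_{i=0}^{r(G)}(-1)^{i}w_i(G,\alpha)k^{|V(G)|-i}$. The chromatic polynomial $P(G;k)$, counting proper $k$-colorings of $G$, is written $P(G;k)=\sum_{i=0}^{r(G)}(-1)^iw_i(G)k^{|V(G)|-i}$. *)

(* Defs.v *)
From HB Require Import structures.
From mathcomp Require Import all_boot all_order all_algebra.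

Set Implicit Arguments.
Unset Strict Implicit.
Unset Printing Implicit Defensive.

Import Order.TTheory GRing.Theory Num.Theory.

Local Open Scope ring_scope.

(* The ends are ordered only so that the two half-edges of an edge, a loop     *)
(* included, have names: adjacency, degrees, components, cycles and colorings  *)
(* do not depend on that order.                                                *)
Record mgraph := MGraph {
  vertex : finType;
  edge : finType;
  ends : edge -> vertex * vertex }.

Section Subgraphs.
Variable G : mgraph.
Local Notation V := (vertex G).
Local Notation E := (edge G).

Definition is_subgraph (H : {set V} * {set E}) : bool :=
  [forall e in H.2, ((ends e).1 \in H.1) && ((ends e).2 \in H.1)].

Definition subgraph : Type := {H : {set V} * {set E} | is_subgraph H}.

Definition vset (H : subgraph) : {set V} := (val H).1.
Definition eset (H : subgraph) : {set E} := (val H).2.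

Lemma whole_subproof : is_subgraph ([set: V], [set: E]).
Proof. by apply/forall_inP => e _; rewrite !inE. Qed.

Definition whole : subgraph := Sub ([set: V], [set: E]) whole_subproof.

Definition spanning (H : subgraph) : bool := vset H == [set: V].

Definition sub_of (H K : subgraph) : bool :=
  (vset H \subset vset K) && (eset H \subset eset K).

Definition adj (F : {set E}) : rel V :=
  fun u v => [exists e in F, (ends e == (u, v)) || (ends e == (v, u))].

Definition ncomp (H : subgraph) : nat := n_comp (adj (eset H)) (vset H).

(* A loop contributes 2 to the degree of its vertex. *)
Definition degree (H : subgraph) (v : V) : nat :=
  (#|[set e in eset H | (ends e).1 == v]|
   + #|[set e in eset H | (ends e).2 == v]|)%N.

Definition is_cycle (C : subgraph) : bool :=
  (ncomp C == 1%N) && [forall v in vset C, degree C v == 2%N].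

Definition gcycle : Type := {C : subgraph | is_cycle C}.

Definition rank : nat := (#|V| - ncomp whole)%N.

End Subgraphs.

Arguments whole G : clear implicits.
Arguments rank G : clear implicits.

Section Assignings.
Variable G : mgraph.
Local Notation V := (vertex G).
Local Notation E := (edge G).

(* [true] means: directed from [(ends e).1] to [(ends e).2]. *)
Definition orientation : Type := E -> bool.

Definition edge_tail (D : orientation) (e : E) : V :=
  if D e then (ends e).1 else (ends e).2.
Definition edge_head (D : orientation) (e : E) : V :=
  if D e then (ends e).2 else (ends e).1.

(* [d] restricts on [E(C)] to one of the two directions in which the cycle [C] *)
(* can be traversed; the values of [d] outside [E(C)] are irrelevant.          *)
Definition is_direction (C : gcycle G) (d : orientation) : bool :=
  [forall v in vset (val C),
     (#|[set e in eset (val C) | edge_tail d e == v]| == 1%N)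
  && (#|[set e in eset (val C) | edge_head d e == v]| == 1%N)].

Definition eta (D : orientation) (o : gcycle G -> orientation)
    (C : gcycle G) (e : E) : int :=
  if e \in eset (val C) then (if D e == o C e then 1 else -1) else 0.

(* The values [false] and [true] stand for 0 and 1. *)
Definition assigning : Type := gcycle G -> bool.

Definition zero_assigning : assigning := fun=> false.

Definition flow_assigning (D : orientation) (o : gcycle G -> orientation)
    (A : finZmodType) (f : E -> A) : assigning :=
  fun C => \sum_(e in eset (val C)) f e *~ eta D o C e != 0.

Definition admissible (D : orientation) (o : gcycle G -> orientation)
    (alpha : assigning) : Prop :=
  exists (A : finZmodType) (f : E -> A),
    forall C : gcycle G, alpha C = flow_assigning D o f C.

Definition compatible (alpha : assigning) (H : subgraph G) : bool :=
  [forall C : gcycle G, sub_of (val C) H ==> ~~ alpha C].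

Definition cycle_assigning_poly (alpha : assigning) : {poly int} :=
  \sum_(H : subgraph G | spanning H && compatible alpha H)
     (-1) ^+ #|eset H| *: 'X^(ncomp H).

(* The [w_i] in [p = \sum_(0 <= i <= rank G) (-1)^i w_i X^(|V(G)| - i)];        *)
(* see [cycle_assigning_polyE] and [chromatic_polyE].                          *)
Definition unsigned_coef (p : {poly int}) (i : nat) : int :=
  (-1) ^+ i * p`_(#|V| - i).

Definition proper_coloring (k : nat) (c : {ffun V -> 'I_k}) : bool :=
  [forall e : E, c (ends e).1 != c (ends e).2].

Lemma adj_sym (F : {set E}) : symmetric (adj F).
Proof. by move=> u v; apply: eq_existsb => e; rewrite orbC. Qed.

Lemma adj_csym (F : {set E}) : connect_sym (adj F).
Proof. exact/sym_connect_sym/adj_sym. Qed.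

Lemma n_comp_adj_le (F : {set E}) : (n_comp (adj F) V <= #|V|)%N.
Proof. exact: max_card. Qed.

Lemma n_comp_adj_mono (F F' : {set E}) : F \subset F' ->
  (n_comp (adj F') V <= n_comp (adj F) V)%N.
Proof.
move=> sFF'; have sub : subrel (connect (adj F)) (connect (adj F')).
  apply: connect_sub => x y /exists_inP [e eF h]; apply: connect1.
  by apply/exists_inP; exists e; rewrite ?(subsetP sFF').
rewrite /n_comp_mem -(@card_in_image _ _ (fingraph.root (adj F))).
  apply: subset_leq_card; apply/subsetP => _ /imageP [x _ ->].
  by rewrite !inE roots_root //; apply: adj_csym.
move=> x y; rewrite !inE !andbT => /eqP rx /eqP ry exy.
rewrite -rx -ry; apply/fingraph.rootP; first exact: adj_csym.
by apply: sub; apply/fingraph.rootP => //; apply: adj_csym.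
Qed.

Lemma ncomp_spanning (H : subgraph G) : spanning H ->
  ncomp H = n_comp (adj (eset H)) V.
Proof. by move/eqP=> sH; apply: eq_n_comp_r => x; rewrite sH !inE. Qed.

Lemma ncomp_wholeE : ncomp (whole G) = n_comp (adj [set: E]) V.
Proof. by rewrite ncomp_spanning // /spanning /vset eqxx. Qed.

Lemma unsigned_coef_expand (p : {poly int}) :
  (forall j, p`_j != 0 -> (ncomp (whole G) <= j <= #|V|)%N) ->
  p = \sum_(i < (rank G).+1) (-1) ^+ i * unsigned_coef p i *: 'X^(#|V| - i).
Proof.
move=> supp; apply/polyP => j; rewrite coef_sum.
under eq_bigr => i _ do
  rewrite coefZ coefXn /unsigned_coef mulrA -exprD addnn -mul2n exprM sqrrN !expr1n mul1r.
have cV : (ncomp (whole G) <= #|V|)%N by rewrite ncomp_wholeE n_comp_adj_le.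
have [pj0|/supp /andP [cj jV]] := eqVneq p`_j 0.
  rewrite pj0 big1 // => i _; case: eqP => [<-|_]; last by rewrite mulr0.
  by rewrite pj0 mul0r.
have lt : (#|V| - j < (rank G).+1)%N by rewrite ltnS leq_sub2l.
rewrite (bigD1 (Ordinal lt)) //= subKn // eqxx mulr1 big1 ?addr0 // => i.
move=> /eqP ne; case: eqP => [ej|_]; last by rewrite mulr0.
case: ne; apply/val_inj => /=; rewrite ej subKn //.
by rewrite (leq_trans (leq_ord i)) // leq_subr.
Qed.

Lemma cycle_assigning_polyE (alpha : assigning) :
  let p := cycle_assigning_poly alpha in
  p = \sum_(i < (rank G).+1) (-1) ^+ i * unsigned_coef p i *: 'X^(#|V| - i).
Proof.
apply: unsigned_coef_expand => j; rewrite coef_sum; apply: contraNT => nj.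
rewrite big1 // => H /andP [sH _]; rewrite coefZ coefXn.
case: eqP => [ej|_]; last by rewrite mulr0.
case/negP: nj; rewrite ej ncomp_wholeE ncomp_spanning //.
by rewrite n_comp_adj_le n_comp_adj_mono ?subsetT.
Qed.

Lemma card_component_colorings (F : {set E}) (k : nat) :
  #|[set c : {ffun V -> 'I_k} |
      [forall e in F, c (ends e).1 == c (ends e).2]]|
    = (k ^ n_comp (adj F) V)%N.
Proof.
set e := adj F; have sym : connect_sym e := adj_csym F.
pose T := {x : V | roots e x}.
pose r x : T := Sub (fingraph.root e x) (roots_root sym x).
pose ext (g : {ffun T -> 'I_k}) := [ffun x => g (r x)].
have rK (t : T) : r (val t) = t by apply/val_inj/eqP; exact: (valP t).
have inj : injective ext.
  move=> g h /ffunP eq_gh; apply/ffunP => t.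
  by have := eq_gh (val t); rewrite !ffunE rK.
have -> : [set c : {ffun V -> 'I_k} | [forall e in F, c (ends e).1 == c (ends e).2]]
   = ext @: [set: {ffun T -> 'I_k}].
  apply/setP => c; rewrite inE; apply/idP/imsetP => [cF|[g _ ->]].
    have cc x y : connect e x y -> c x = c y.
      case/connectP => p; elim: p x => [|z p IH] x /=; first by move=> _ ->.
      case/andP => /exists_inP [a aF h] pz lst; rewrite -(IH z) //.
      have /eqP := forall_inP cF a aF.
      by case/orP: h => /eqP -> //=.
    exists [ffun t => c (val t)] => //; apply/ffunP => x.
    by rewrite !ffunE /=; apply: cc; apply: connect_root.
  apply/forall_inP => a aF; rewrite !ffunE; apply/eqP; congr (g _).
  apply/val_inj => /=; apply/fingraph.rootP => //; apply: connect1.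
  by apply/exists_inP; exists a => //; rewrite -surjective_pairing eqxx.
rewrite card_imset // cardsT card_ffun card_ord /T card_sig; congr (_ ^ _)%N.
by apply: eq_card => x; rewrite !inE andbT.
Qed.

Lemma chromatic_poly_key : {p : {poly int} |
  [/\ forall k : nat, p.[k%:R] = #|[set c | @proper_coloring k c]|%:R
    & forall j, p`_j != 0 -> (ncomp (whole G) <= j <= #|V|)%N]}.
Proof.
exists (\sum_(F : {set E}) (-1) ^+ #|F| *: 'X^(n_comp (adj F) V)); split; last first.
  move=> j; rewrite coef_sum; apply: contraNT => nj.
  rewrite big1 // => F _; rewrite coefZ coefXn.
  case: eqP => [ej|_]; last by rewrite mulr0.
  by case/negP: nj; rewrite ej ncomp_wholeE n_comp_adj_le n_comp_adj_mono ?subsetT.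
move=> k; rewrite horner_sum.
transitivity (\sum_(F : {set E}) \sum_(c : {ffun V -> 'I_k})
   \prod_(e in F) - ((c (ends e).1 == c (ends e).2)%:R : int)).
  apply: eq_bigr => F _; rewrite hornerZ hornerXn -natrX -card_component_colorings.
  rewrite -[X in X%:R]sum1_card natr_sum mulr_sumr big_mkcond /=.
  apply: eq_bigr => c _; rewrite prodrN.
  rewrite inE; case: forall_inP => [h|h].
    by rewrite big1 // => e eF; rewrite h.
  case: (altP (@forall_inP _ (mem F) (fun e => c (ends e).1 == c (ends e).2))) => // h'.
  have [e eF /negPf ne] : exists2 e, e \in F & c (ends e).1 != c (ends e).2.
    by move: h'; rewrite negb_forall_in => /exists_inP.
  by rewrite (bigD1 e) //= ne mul0r mulr0.
rewrite exchange_big /= -sum1_card natr_sum [RHS]big_mkcond /=.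
apply: eq_bigr => c _; rewrite inE.
have -> : \sum_(F : {set E}) \prod_(e in F) - ((c (ends e).1 == c (ends e).2)%:R : int)
  = \prod_(e : E) (- ((c (ends e).1 == c (ends e).2)%:R : int) + 1).
  rewrite bigA_distr /=; apply: eq_bigr => F _.
  by rewrite -big_mkcond.
rewrite /proper_coloring; case: (altP forallP) => h.
  by rewrite big1 // => e _; rewrite (negPf (h e)) oppr0 add0r.
have /existsP [e /negPn he] : [exists e, ~~ (c (ends e).1 != c (ends e).2)].
  by rewrite -negb_forall.
by rewrite (bigD1 e) //= he addNr mul0r.
Qed.

(* Characterized by [chromatic_polyP] and [chromatic_poly_uniq]. *)
Definition chromatic_poly : {poly int} := sval chromatic_poly_key.

Lemma chromatic_polyP (k : nat) :
  chromatic_poly.[k%:R] = #|[set c | @proper_coloring k c]|%:R.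
Proof. by case: (svalP chromatic_poly_key) => + _; apply. Qed.

Lemma chromatic_poly_uniq (p : {poly int}) :
  (forall k : nat, p.[k%:R] = #|[set c | @proper_coloring k c]|%:R) ->
  p = chromatic_poly.
Proof.
move=> pP; apply/eqP; rewrite -subr_eq0; apply/eqP.
set q := p - _; pose rs := [seq (k%:R : int) | k <- iota 0 (size q)].
apply: (@roots_geq_poly_eq0 _ _ rs).
- apply/allP => _ /mapP [k _ ->].
  by rewrite /root !hornerE pP chromatic_polyP subrr.
- by rewrite map_inj_uniq ?iota_uniq // => m n /eqP; rewrite eqr_nat => /eqP.
- by rewrite size_map size_iota.
Qed.

Lemma chromatic_polyE :
  chromatic_poly = \sum_(i < (rank G).+1)
    (-1) ^+ i * unsigned_coef chromatic_poly i *: 'X^(#|V| - i).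
Proof. by apply: unsigned_coef_expand; case: (svalP chromatic_poly_key). Qed.

End Assignings.

Arguments chromatic_poly G : clear implicits.
Arguments zero_assigning G : clear implicits.

(* Main.v *)
Require Import Defs.
From mathcomp Require Import all_boot all_order all_algebra.
From mathcomp Require Import ring.

Set Implicit Arguments.
Unset Strict Implicit.
Unset Printing Implicit Defensive.

Import Order.TTheory GRing.Theory Num.Theory.

Local Open Scope ring_scope.

(** The proof is a version of Whitney's broken cycle theorem. Order the edges, and
    call broken cycle any cycle [C] with [alpha C = 0], minus its largest edge. For
    admissible [alpha], the coefficient [w_i(G, alpha)] is the number of forests
    with [i] edges that contain no broken cycle
    ([unsigned_coef_broken_cycle_free]). If [alpha <= alpha'], then the cycles of
    value 0 for [alpha'] are among those for [alpha], so there are fewer broken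
    cycles to avoid and at least as many forests are counted
    ([broken_cycle_freeW]).

    For the broken cycle theorem, let the pivot of an edge set [F] be the least
    edge [e] that completes to a cycle some broken cycle contained in [F]. Adding or
    deleting the pivot is a sign-reversing involution on the compatible edge sets
    that contain a broken cycle, so the terms of these sets cancel
    ([toggle_cancel], [cycle_assigning_poly_broken_cycle_free]). The remaining
    compatible sets contain no cycle at all, since their cycles would have value 0
    and contain broken cycles; and a forest with [i] edges has [|V| - i]
    components ([acyclic_n_comp]).

    Two facts make the involution work. The number of components does not change
    when [e] closes a cycle with edges of [F] ([cycle_chord]). And if that cycle
    has value 0, then [F] with [e] added is still compatible
    ([compatible_edgesU1]): this is where [alpha] has to come from a function
    [f] into an Abelian group. Both facts come from integer circulations. The net
    flow across a cut is zero, which gives the first. For the second, the support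
    of a nonzero circulation contains a cycle ([circulation_cycle]), so that [f] is
    orthogonal to every circulation supported in a set all of whose cycles have
    sum 0 ([circulation_orthogonal]).

    The chromatic polynomial is the case of the zero assigning, for which all edge
    sets are compatible and the sum is inclusion-exclusion over monochromatic
    edges ([chromatic_poly_zero_assigning]). *)

(** * Sign-reversing involutions on edge sets *)
Section Toggling.
Variable E : finType.

Definition toggle (e : E) (F : {set E}) : {set E} :=
  if e \in F then F :\ e else e |: F.

Lemma toggleK e : involutive (toggle e).
Proof.
move=> F; rewrite /toggle; have [eF|eF] := boolP (e \in F).
  by rewrite !inE eqxx /= setD1K.
by rewrite !inE eqxx /= setU1K.
Qed.

Lemma in_toggle e F : (e \in toggle e F) = (e \notin F).
Proof. by rewrite /toggle; case: ifP => eF; rewrite !inE eqxx. Qed.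

Lemma sign_toggle e F : (-1) ^+ #|toggle e F| = - (-1) ^+ #|F| :> int.
Proof.
rewrite /toggle; case: ifP => eF; last by rewrite cardsU1 eF exprS mulN1r.
by rewrite (cardsD1 e F) eF exprS mulN1r opprK.
Qed.

(** The terms with a pivot come in pairs [F], [toggle e F] with opposite values,
    because toggling the pivot [e] leaves the pivot unchanged. *)
Lemma toggle_cancel (M : zmodType) (P : pred {set E})
    (pivot : {set E} -> option E) (t : {set E} -> M) :
  (forall F e, P F -> pivot F = Some e ->
     [/\ P (toggle e F), pivot (toggle e F) = Some e
       & t (toggle e F) = - t F]) ->
  \sum_(F | P F) t F = \sum_(F | P F && (pivot F == None)) t F.
Proof.
move=> tog; rewrite (bigID (fun F => pivot F == None)) /= -[RHS]addr0.
congr (_ + _).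
pose up F := if pivot F is Some e then e \in F else false.
pose h F := if P F then if pivot F is Some e then toggle e F else F else F.
have hK : involutive h.
  move=> F; rewrite /h; case PF: (P F); last by rewrite /= PF.
  case eF: (pivot F) => [e|]; last by rewrite /= PF eF.
  by have [-> -> _] := tog F e PF eF; rewrite toggleK.
(* [h] exchanges the sets that contain their pivot with those that do not. *)
rewrite (bigID up) /= [X in _ + X](reindex_inj (inv_inj hK)) /= -[RHS](addrN
  (\sum_(F | P F && (pivot F != None) && up F) t F)) -sumrN; congr (_ + _).
apply: eq_big => [F|F]; rewrite /h /up.
  case PF: (P F); last by rewrite /= PF.
  case eF: (pivot F) => [e|]; last by rewrite /= PF eF.
  by have [-> -> _] := tog F e PF eF; rewrite in_toggle negbK.
case PF: (P F); last by rewrite /= PF.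
case eF: (pivot F) => [e|]; last by rewrite /= PF eF.
by have [_ _ ->] := tog F e PF eF.
Qed.

End Toggling.

(** * Components of a spanning subgraph when one edge is added *)
Section Components.
Variable G : mgraph.
Local Notation V := (vertex G).
Local Notation E := (edge G).

Definition acyclic (F : {set E}) : bool :=
  [forall C : gcycle G, ~~ (eset (val C) \subset F)].

Lemma connect_adj_mono (F F' : {set E}) u v : F \subset F' ->
  connect (adj F) u v -> connect (adj F') u v.
Proof.
move=> sFF'; apply: connect_sub => x y /exists_inP [e eF h]; apply: connect1.
by apply/exists_inP; exists e; rewrite ?(subsetP sFF').
Qed.

Lemma connect_edge (F : {set E}) e : e \in F ->
  connect (adj F) (ends e).1 (ends e).2.
Proof.
move=> eF; apply/connect1/exists_inP; exists e => //.
by rewrite -surjective_pairing eqxx.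
Qed.

Lemma n_comp_adj_chord (F : {set E}) e :
  connect (adj F) (ends e).1 (ends e).2 ->
  n_comp (adj (e |: F)) V = n_comp (adj F) V.
Proof.
move=> ce; apply: eq_n_comp => u v; apply/idP/idP; last first.
  by apply: connect_adj_mono; apply: subsetUr.
apply: connect_sub => x y /exists_inP [a].
rewrite !inE => /orP [/eqP ->|aF] /orP [] /eqP ea; move: ce; rewrite ?ea //.
- by rewrite (adj_csym F x y).
- by move=> _; have := connect_edge aF; rewrite ea.
by move=> _; have := connect_edge aF; rewrite ea (adj_csym F x y).
Qed.

(** Counted through 2-colorings constant on components, of which there are
    [2 ^ n_comp]: flipping the colors on the component of one end of [e] exchanges
    the colorings that agree on the two ends of [e] with those that do not, so
    adding [e] halves their number. *)
Lemma n_comp_adj_bridge (F : {set E}) e :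
  ~~ connect (adj F) (ends e).1 (ends e).2 ->
  n_comp (adj F) V = (n_comp (adj (e |: F)) V).+1.
Proof.
set u := (ends e).1; set w := (ends e).2 => nc.
pose mono (F' : {set E}) := [set c : {ffun V -> 'I_2} |
   [forall a in F', c (ends a).1 == c (ends a).2]].
apply: (@expnI 2) => //; rewrite expnS -!card_component_colorings -!/(mono _).
pose flip (c : {ffun V -> 'I_2}) : {ffun V -> 'I_2} :=
  [ffun x => if connect (adj F) u x then rev_ord (c x) else c x].
have flipK : involutive flip.
  by move=> c; apply/ffunP => x; rewrite !ffunE; case: connect; rewrite ?rev_ordK.
have flip_mono c : (flip c \in mono F) = (c \in mono F).
  rewrite !inE; apply: eq_forallb_in => a aF; rewrite !ffunE.
  have ca : connect (adj F) u (ends a).1 = connect (adj F) u (ends a).2.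
    by apply: same_connect_r; [apply: adj_csym | apply: connect_edge].
  by rewrite ca; case: ifP => // _; rewrite (inj_eq rev_ord_inj).
have rev2 (i j : 'I_2) : (rev_ord i == j) = (i != j).
  by case: i j => [[|[|//]] ?] [[|[|//]] ?].
have -> : mono (e |: F) = mono F :&: [set c : {ffun V -> 'I_2} | c u == c w].
  apply/setP => c; rewrite !inE; apply/forall_inP/andP => [h|[/forall_inP h cuw] a].
    split; last by apply: h; rewrite !inE eqxx.
    by apply/forall_inP => a aF; apply: h; rewrite !inE aF orbT.
  by rewrite !inE => /orP [/eqP ->|/h].
rewrite mul2n -addnn -(cardsID [set c : {ffun V -> 'I_2} | c u == c w] (mono F)).
congr (_ + _)%N.
rewrite -[LHS](card_imset _ (inv_inj flipK)); apply: eq_card => c.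
apply/imsetP/idP => [[b bm ->]|cm]; last first.
  exists (flip c); rewrite ?flipK //; move: cm.
  rewrite in_setI in_setD flip_mono => /andP [-> h]; move: h.
  by rewrite !in_set !ffunE connect0 (negPf nc) rev2 andbT negbK.
move: bm; rewrite in_setI in_setD flip_mono => /andP [h ->]; move: h.
by rewrite !in_set !ffunE connect0 (negPf nc) rev2 andTb.
Qed.

(** A cycle has a vertex, being connected, and that vertex has degree 2. *)
Lemma cycle_has_edge (C : gcycle G) : exists e, e \in eset (val C).
Proof.
apply/set0Pn/eqP => C0; have /andP [/eqP c1 /forall_inP d2] := valP C.
have [v vC] : exists v, v \in vset (val C).
  apply/set0Pn/eqP => V0; move: c1; rewrite /ncomp V0.
  by rewrite /n_comp_mem eq_card0 // => v; rewrite !inE andbF.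
by have := d2 v vC; rewrite /degree C0 !eq_card0 // => b; rewrite !inE.
Qed.

Lemma acyclicW (F F' : {set E}) : F \subset F' -> acyclic F' -> acyclic F.
Proof.
move=> sFF' /forallP acF'; apply/forallP => C.
by apply: contraNN (acF' C) => sCF; apply: subset_trans sCF sFF'.
Qed.

Lemma n_comp_adj0 : n_comp (adj set0) V = #|V|.
Proof.
apply: (@expnI 2) => //; rewrite -card_component_colorings.
transitivity #|{ffun V -> 'I_2}|; last by rewrite card_ffun card_ord.
apply: eq_card => c; rewrite inE; apply/forall_inP => e; by rewrite inE.
Qed.

End Components.

(** * Integer circulations *)
Section Circulations.
Variable G : mgraph.
Local Notation V := (vertex G).
Local Notation E := (edge G).
Variable D : orientation G.

(** Orthogonality to all coboundaries. Taking [p] to be the indicator of a vertex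
    gives the usual conservation law there; taking it to be the indicator of a
    vertex set gives the vanishing of the net flow across a cut. *)
Definition circulation (x : E -> int) : Prop := forall p : V -> int,
  \sum_e x e * (p (edge_head D e) - p (edge_tail D e)) = 0.

Lemma reorient_diff (d : orientation G) (p : V -> int) e :
  p (edge_head d e) - p (edge_tail d e) =
  (if D e == d e then 1 else -1) * (p (edge_head D e) - p (edge_tail D e)).
Proof. by rewrite /edge_head /edge_tail; case: (D e); case: (d e) => /=; ring. Qed.

Lemma adj_step (d : orientation G) (F : {set E}) e :
  e \in F -> adj F (edge_tail d e) (edge_head d e).
Proof.
move=> eF; apply/exists_inP; exists e => //.
by rewrite /edge_tail /edge_head; case: (d e); rewrite -surjective_pairing eqxx ?orbT.
Qed.

Lemma degree_orientation (d : orientation G) (C : subgraph G) v :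
  degree C v = (#|[set e in eset C | edge_tail d e == v]|
              + #|[set e in eset C | edge_head d e == v]|)%N.
Proof.
have sum1 (h : E -> V) : #|[set e in eset C | h e == v]| =
    (\sum_(e in eset C) (h e == v))%N.
  rewrite -sum1dep_card [RHS]big_mkcond /= [LHS]big_mkcond /=.
  by apply: eq_bigr => e _; case: (e \in _); case: (_ == _).
rewrite /degree !sum1 -!big_split /=; apply: eq_bigr => e _.
by rewrite /edge_tail /edge_head; case: (d e); rewrite // addnC.
Qed.

Lemma periodic_point (T : finType) (phi : T -> T) (x : T) :
  exists k m, iter m.+1 phi (iter k phi x) = iter k phi x.
Proof.
have /trajectP [k lt ek] := looping_order phi x.
by exists k, (order phi x - k).-1; rewrite prednK ?subn_gt0 // -iterD subnK // ltnW.
Qed.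

(** When every vertex [v] of a periodic orbit of the successor map has [g v] as
    its outgoing edge, these edges form a directed cycle: the successor map permutes
    the orbit, so every vertex has exactly one outgoing and one incoming edge. *)
Lemma is_cycle_orbit (d : orientation G) (g : V -> E) (w : V) m :
  let phi v := edge_head d (g v) in
  (forall i, edge_tail d (g (iter i phi w)) = iter i phi w) ->
  iter m.+1 phi w = w ->
  exists C : gcycle G, forall e, e \in eset (val C) ->
    exists i, e = g (iter i phi w).
Proof.
move=> phi tail_g per.
pose S := [set v | fconnect phi w v].
have SP v : reflect (exists i, v = iter i phi w) (v \in S).
  rewrite inE; apply: (iffP idP) => [c|[i ->]]; last exact: fconnect_iter.
  by exists (findex phi w v); rewrite iter_findex.
have phiS v : v \in S -> phi v \in S.
  by case/SP => i ->; apply/SP; exists i.+1.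
have tailS v : v \in S -> edge_tail d (g v) = v by case/SP => i ->.
have perS v : v \in S -> iter m phi (phi v) = v.
  by case/SP => i ->; rewrite -iterSr -iterD addnC iterD per.
pose F := g @: S.
have sub : is_subgraph (S, F).
  apply/forall_inP => _ /imsetP [v vS ->] /=.
  have h : (edge_tail d (g v) \in S) && (edge_head d (g v) \in S).
    by rewrite tailS // vS; apply: phiS.
  by move: h; rewrite /edge_tail /edge_head; case: (d _) => //; rewrite andbC.
pose C : subgraph G := Sub (S, F) sub.
have card_tail v : v \in S -> #|[set e in F | edge_tail d e == v]| = 1%N.
  move=> vS; rewrite -(cards1 (g v)); apply: eq_card => e; rewrite !inE.
  apply/andP/eqP => [[/imsetP [u uS ->]]|->]; first by rewrite tailS // => /eqP ->.
  by rewrite tailS // eqxx; split => //; apply: imset_f.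
have card_head v : v \in S -> #|[set e in F | edge_head d e == v]| = 1%N.
  move=> vS; rewrite -(cards1 (g (iter m phi v))); apply: eq_card => e; rewrite !inE.
  have mS : iter m phi v \in S.
    by case/SP: vS => i ->; apply/SP; exists (m + i)%N; rewrite iterD.
  apply/andP/eqP => [[/imsetP [u uS ->]]|->].
    by move/eqP=> <-; rewrite perS.
  split; first exact: imset_f.
  by rewrite -[X in _ == X]perS // -iterSr.
have conn v : (v \in S) = connect (adj F) w v.
  apply/idP/idP => [/SP [i ->]|].
    elim: i => [|i IH]; first exact: connect0.
    apply: connect_trans IH (connect1 _) => /=.
    have iS : iter i phi w \in S by apply/SP; exists i.
    by rewrite -[X in adj _ X _]tailS //; apply: adj_step; apply: imset_f.
  have wS : w \in S by rewrite inE connect0.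
  suff cl : closed (adj F) (mem S) by move/(closed_connect cl) => <-.
  apply: intro_closed => [|a b /exists_inP [e eF h] aS]; first exact: adj_csym.
  have /andP := forall_inP sub e eF; case/orP: h => /eqP -> /=; by case.
have cycC : is_cycle C.
  apply/andP; split; last first.
    apply/forall_inP => v vS; rewrite (degree_orientation d).
    by rewrite /eset /= card_tail // card_head.
  rewrite /ncomp (eq_n_comp_r conn) n_comp_connect //.
  exact: adj_csym.
exists (Sub C cycC) => e /= /imsetP [v /SP [i ->] ->]; by exists i.
Qed.

(** Direct each edge of the support so that the flow becomes positive. By
    conservation, the head of a support edge has an outgoing support edge, so
    one can walk along the support forever and must enter a directed cycle. *)
Lemma circulation_cycle (x : E -> int) e0 : circulation x -> x e0 != 0 ->
  exists C : gcycle G, forall e, e \in eset (val C) -> x e != 0.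
Proof.
move=> circ x0.
pose d : orientation G := fun e => D e == (0 < x e).
(* With respect to [d] the circulation is [`|x|]. *)
have absx (p : V -> int) :
    \sum_e `|x e| * (p (edge_head d e) - p (edge_tail d e)) = 0.
  rewrite -[RHS](circ p); apply: eq_bigr => e _.
  rewrite (reorient_diff d) mulrA; congr (_ * _); rewrite /d.
  case: (ltrP 0 (x e)) => xe.
    by rewrite gtr0_norm //; case: (D e); rewrite mulr1.
  by rewrite ler0_norm //; case: (D e); rewrite mulrN1 opprK.
pose out v e := (x e != 0) && (edge_tail d e == v).
pose g v := odflt e0 [pick e | out v e].
pose phi v := edge_head d (g v).
have gP v e : out v e -> out v (g v).
  by rewrite /g => ove; case: pickP => [//|/(_ e)]; rewrite ove.
have out_head e : x e != 0 -> exists e', out (edge_head d e) e'.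
  move=> xe; apply/existsP; apply: contraT; rewrite negb_exists => /forallP no.
  set u := edge_head d e in no.
  (* Without an outgoing edge, the net flow into [u] would be positive. *)
  have := absx (fun v => (v == u)%:R).
  suff pos : 0 < \sum_a `|x a| * ((edge_head d a == u)%:R - (edge_tail d a == u)%:R).
    by move=> z; rewrite z ltxx in pos.
  have tail0 a : `|x a| * (edge_tail d a == u)%:R = 0.
    have := no a; rewrite negb_and negbK => /orP [/eqP ->|/negPf ->].
      by rewrite normr0 mul0r.
    by rewrite mulr0.
  under eq_bigr => a _ do rewrite mulrBr tail0 subr0.
  rewrite (bigD1 e) //= eqxx mulr1 ltr_wpDr ?normr_gt0 //.
  by apply: sumr_ge0 => a _; rewrite mulr_ge0.
pose v0 := edge_tail d e0.
have live i : exists e, out (iter i phi v0) e.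
  elim: i => [|i [e oe]]; first by exists e0; rewrite /out x0 eqxx.
  by have /andP [xg _] := gP _ _ oe; apply: out_head xg.
have liveg i : out (iter i phi v0) (g (iter i phi v0)).
  by have [e /gP] := live i.
have [k [m per]] := periodic_point phi v0.
have [|C CP] := @is_cycle_orbit d g (iter k phi v0) m _ per.
  by move=> i; rewrite -/phi -iterD; have /andP [_ /eqP] := liveg (i + k)%N.
exists C => e /CP [i ->]; rewrite -/phi -iterD.
by have /andP [] := liveg (i + k)%N.
Qed.

(** The signed indicator of a path: the sum telescopes along it. *)
Lemma path_flow (F : {set E}) u v : connect (adj F) u v ->
  exists2 x : E -> int, (forall e, e \notin F -> x e = 0) &
    forall p : V -> int,
      \sum_e x e * (p (edge_head D e) - p (edge_tail D e)) = p v - p u.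
Proof.
move=> /connectP [s + ->]; elim: s u => [|z s IH] u /=.
  move=> _; exists (fun=> 0) => // p.
  by rewrite subrr big1 // => e _; rewrite mul0r.
case/andP=> /exists_inP [a aF h] /IH [x x0 xp].
pose y : int := if D a == (ends a == (u, z)) then 1 else -1.
exists (fun e => x e + (if e == a then y else 0)) => [e eF|p].
  rewrite x0 // ifN ?addr0 //; by apply: contraNneq eF => ->.
under eq_bigr => e _ do rewrite mulrDl.
rewrite big_split /= xp (bigD1 a) //= eqxx [X in _ + (_ + X)]big1 ?addr0; last first.
  by move=> e /negPf ->; rewrite mul0r.
suff -> : y * (p (edge_head D a) - p (edge_tail D a)) = p z - p u by ring.
rewrite /y; have [ea|ne] := eqVneq (ends a) (u, z).
  by rewrite /edge_head /edge_tail ea; case: (D a) => /=; ring.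
move: h; rewrite (negPf ne) /= => /eqP ea.
by rewrite /edge_head /edge_tail ea; case: (D a) => /=; ring.
Qed.

(** A path in [F :\ e] between the ends of [e], closed up by [e], would carry a
    nonzero circulation supported in [F], whose support would contain a cycle. *)
Lemma acyclic_bridge (F : {set E}) e : acyclic F -> e \in F ->
  ~~ connect (adj (F :\ e)) (ends e).1 (ends e).2.
Proof.
move=> acF eF; apply/negP => ce.
have {ce} c : connect (adj (F :\ e)) (edge_head D e) (edge_tail D e).
  by rewrite /edge_head /edge_tail; case: (D e) => //; rewrite adj_csym.
have [x x0 xp] := path_flow c.
have xe : x e = 0 by rewrite x0 // !inE eqxx.
pose y a := x a + (a == e)%:R.
have circ : circulation y.
  move=> p; under eq_bigr => a _ do rewrite mulrDl.
  rewrite big_split /= xp (bigD1 e) //= eqxx mul1r big1 => [|a /negPf ->]; last first.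
    by rewrite mul0r.
  by ring.
have [|C CP] := circulation_cycle (e0 := e) circ; first by rewrite /y xe eqxx.
have /negP := forallP acF C; apply; apply/subsetP => a /CP; apply: contraNT => aF.
rewrite /y x0 ?add0r; last by rewrite !inE negb_and aF orbT.
by case: (a =P e) => // ae; rewrite ae eF in aF.
Qed.

Variables (o : gcycle G -> orientation G).
Hypothesis ho : forall C : gcycle G, is_direction C (o C).

Lemma circulation_eta (C : gcycle G) : circulation (eta D o C).
Proof.
move=> p.
have sumV (h : E -> V) : (forall e, e \in eset (val C) -> h e \in vset (val C)) ->
    (forall v, v \in vset (val C) ->
       #|[set e in eset (val C) | h e == v]| == 1%N) ->
    \sum_(e in eset (val C)) p (h e) = \sum_(v in vset (val C)) p v.
  move=> hV h1; rewrite (partition_big h (mem (vset (val C)))) //=.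
  apply: eq_bigr => v /h1 /eqP cv; under eq_bigr => e /andP [_ /eqP ->] do [].
  rewrite sumr_const -[RHS]mulr1n; congr (_ *+ _); rewrite -cv.
  by apply: eq_card => e; rewrite !inE.
have inV e : e \in eset (val C) ->
    ((ends e).1 \in vset (val C)) && ((ends e).2 \in vset (val C)).
  by move=> eC; apply: (forall_inP (valP (val C))).
have dir v (vC : v \in vset (val C)) := andP (forall_inP (ho C) v vC).
transitivity (\sum_(e in eset (val C))
    (p (edge_head (o C) e) - p (edge_tail (o C) e))).
  rewrite [RHS]big_mkcond /=; apply: eq_bigr => e _; rewrite /eta.
  by case: ifP => _; rewrite ?mul0r // [RHS]reorient_diff.
rewrite sumrB !sumV ?subrr // =>
  [e /inV /andP [e1 e2]|v /dir []|e /inV /andP [e1 e2]|v /dir []] //.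
  by rewrite /edge_tail; case: ifP.
by rewrite /edge_head; case: ifP.
Qed.

Lemma eta_neq0 (C : gcycle G) e : (eta D o C e != 0) = (e \in eset (val C)).
Proof. by rewrite /eta; case: ifP => //; case: ifP. Qed.

Lemma eta_sqr (C : gcycle G) e : e \in eset (val C) -> eta D o C e * eta D o C e = 1.
Proof. by rewrite /eta => ->; case: ifP. Qed.

(** The net flow of the cycle across the cut around the component of one end of
    [e] is zero, and no edge of [F] crosses that cut; so [e] does not cross it. *)
Lemma cycle_chord (C : gcycle G) (F : {set E}) e :
  e \in eset (val C) -> eset (val C) :\ e \subset F ->
  connect (adj F) (ends e).1 (ends e).2.
Proof.
move=> eC sF; pose p v : int := (connect (adj F) (ends e).1 v)%:R.
have /eqP := circulation_eta C p; rewrite (bigD1 e) //= big1 ?addr0; last first.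
  move=> a ae; have [aC|] := boolP (a \in eset (val C)); last first.
    by rewrite -eta_neq0 negbK => /eqP ->; rewrite mul0r.
  suff -> : p (edge_head D a) = p (edge_tail D a) by rewrite subrr mulr0.
  have aF : a \in F by apply: (subsetP sF); rewrite !inE ae.
  by rewrite /p (same_connect_r (adj_csym F) (connect1 (adj_step D aF))).
rewrite mulf_eq0 (negPf (_ : eta D o C e != 0)) ?eta_neq0 //= subr_eq0.
rewrite /p /edge_head /edge_tail; case: (D e); rewrite connect0;
  by case: connect.
Qed.

(** Circulations are generated by cycles. The induction removes one support edge
    at a time: the support contains a cycle, and a multiple of its signed indicator
    cancels the value at a chosen edge without leaving the support. This works
    with either direction of the cycle, so it does not matter that [o C] may be
    opposite to the direction in which the support traverses [C]. *)
Lemma circulation_orthogonal (A : zmodType) (f : E -> A) (F : {set E}) x :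
  circulation x -> (forall e, x e != 0 -> e \in F) ->
  (forall C : gcycle G, eset (val C) \subset F ->
     \sum_e f e *~ eta D o C e = 0) ->
  \sum_e f e *~ x e = 0.
Proof.
move=> circ xF bal; have [n] := ubnP #|[set e | x e != 0]|.
elim: n x circ xF => // n IH x circ xF; rewrite ltnS => ltn.
have [e xe|x0] := pickP (fun e => x e != 0); last first.
  by rewrite big1 // => e _; have /negbFE /eqP -> := x0 e; rewrite mulr0z.
have [C CP] := circulation_cycle circ xe.
have CF : eset (val C) \subset F by apply/subsetP => a /CP /xF.
have [a aC] := cycle_has_edge C.
pose c := x a * eta D o C a.
pose y b := x b - c * eta D o C b.
have ya : y a = 0 by rewrite /y /c -mulrA eta_sqr // mulr1 subrr.
have supp b : y b != 0 -> x b != 0.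
  apply: contraNN => /eqP xb; rewrite /y xb sub0r oppr_eq0.
  have [/CP|] := boolP (b \in eset (val C)); first by rewrite xb eqxx.
  by rewrite -eta_neq0 negbK => /eqP ->; rewrite mulr0.
have := IH y; have -> : \sum_b f b *~ y b = \sum_b f b *~ x b.
  under eq_bigr => b _ do rewrite /y mulrzBr mulrC mulrzA.
  rewrite sumrB -[X in _ - X](_ : (\sum_b f b *~ eta D o C b) *~ c = _).
    by rewrite bal // mul0rz subr0.
  by rewrite mulrz_suml.
apply.
- move=> p; under eq_bigr => b _ do rewrite /y mulrBl -mulrA.
  by rewrite sumrB circ -mulr_sumr circulation_eta mulr0 subrr.
- by move=> b /supp /xF.
apply: leq_trans ltn; apply: proper_card; apply/properP; split.
  by apply/subsetP => b; rewrite !inE => /supp.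
by exists a; rewrite !inE ?ya ?eqxx // CP.
Qed.

End Circulations.

(** * Broken cycles *)
Section BrokenCycles.
Variable G : mgraph.
Local Notation V := (vertex G).
Local Notation E := (edge G).
Implicit Types (alpha : assigning G) (F : {set E}).

(** Every edge of a forest is a bridge, so each one lowers the number of
    components by 1. *)
Lemma acyclic_n_comp F : acyclic F -> (n_comp (adj F) V + #|F| = #|V|)%N.
Proof.
have [n] := ubnP #|F|; elim: n F => // n IH F; rewrite ltnS => ltn acF.
have [F0|[e eF]] := set_0Vmem F; first by rewrite F0 n_comp_adj0 cards0 addn0.
have := n_comp_adj_bridge (acyclic_bridge (fun=> true) acF eF).
rewrite setD1K // (cardsD1 e F) eF addnS -addSn => <-.
apply: IH; first by move: ltn; rewrite (cardsD1 e F) eF.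
by apply: acyclicW acF; apply: subsetDl.
Qed.

Definition compatible_edges alpha F : bool :=
  [forall C : gcycle G, (eset (val C) \subset F) ==> ~~ alpha C].

Lemma cycle_assigning_poly_edges alpha :
  cycle_assigning_poly alpha =
    \sum_(F | compatible_edges alpha F) (-1) ^+ #|F| *: 'X^(n_comp (adj F) V).
Proof.
have spanP F : is_subgraph ([set: V], F).
  by apply/forall_inP => e _; rewrite !inE.
pose span F : subgraph G := Sub ([set: V], F) (spanP F).
rewrite /cycle_assigning_poly (reindex_onto span (@eset G)) /=; last first.
  move=> H /andP [/eqP sH _]; apply/val_inj => /=.
  by rewrite -sH; case: H {sH} => [[]].
apply: eq_big => [F|F /andP [/andP [sF _] _]].
  rewrite /spanning /vset /= !eqxx andbT /=; apply: eq_forallb => C.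
  by rewrite /sub_of /vset /= subsetT.
by rewrite ncomp_spanning.
Qed.

Lemma acyclic_compatible alpha F : acyclic F -> compatible_edges alpha F.
Proof. by move/forallP => acF; apply/forallP => C; rewrite (negPf (acF C)). Qed.

(** [completes alpha F e] says that [F] contains the broken cycle obtained from a
    cycle of value 0 by deleting its largest edge [e], in the order given by
    [enum_rank]. *)
Definition completes alpha F e : bool :=
  [exists C : gcycle G, [&& ~~ alpha C, e \in eset (val C),
     eset (val C) :\ e \subset F
   & [forall a in eset (val C), (enum_rank a <= enum_rank e)%N]]].

Definition pivot alpha F : option E :=
  [pick e | completes alpha F e
            && [forall a, completes alpha F a ==> (enum_rank e <= enum_rank a)%N]].

Lemma pivotP alpha F e :
  reflect (completes alpha F e /\
           forall a, completes alpha F a -> (enum_rank e <= enum_rank a)%N)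
          (pivot alpha F == Some e).
Proof.
rewrite /pivot; case: pickP => [b /andP [bF /forallP bmin]|none].
  apply: (iffP eqP) => [[<-]|[eF emin]].
    by split=> // a; apply/implyP.
  congr Some; apply/enum_rank_inj/val_inj/eqP.
  by rewrite eqn_leq emin // (implyP (bmin e)).
apply: (iffP eqP) => // -[eF emin]; have /andP := none e; case; split=> //.
by apply/forallP => a; apply/implyP/emin.
Qed.

Lemma pivot_NoneP alpha F :
  reflect (forall e, ~~ completes alpha F e) (pivot alpha F == None).
Proof.
apply: (iffP eqP) => [p0 e|no]; last first.
  by rewrite /pivot; case: pickP => // b /andP [bF]; have := no b; rewrite bF.
apply/negP => eF; suff [b] : exists b, pivot alpha F == Some b by rewrite p0.
case: (arg_minnP (fun a => enum_rank a : nat) eF) => b bF bmin; exists b.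
by apply/pivotP.
Qed.

(** A broken cycle completed by [a] consists of edges smaller than [a], so it does
    not contain any [e] with [a <= e]. This is why the pivot, being the least
    completing edge, survives its own toggling. *)
Lemma completes_toggle alpha F e a :
  (enum_rank a <= enum_rank e)%N ->
  completes alpha (toggle e F) a = completes alpha F a.
Proof.
move=> ae; apply: eq_existsb => C.
case: (alpha C) => //=; have [aC|//] := boolP (a \in eset (val C)) => /=.
case: forall_inP => amax; last by rewrite !andbF.
rewrite !andbT; suff eN : e \notin eset (val C) :\ a.
  rewrite /toggle; case: ifP => eF; first by rewrite subsetD1 eN andbT.
  by rewrite -[in RHS](setU1K (negbT eF)) subsetD1 eN andbT.
rewrite !inE negb_and negbK.
have [eC|] := boolP (e \in eset (val C)); rewrite ?orbT // orbF.
by apply/eqP/enum_rank_inj/val_inj/eqP; rewrite eqn_leq ae amax.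
Qed.

Lemma pivot_toggle alpha F e :
  pivot alpha F = Some e -> pivot alpha (toggle e F) = Some e.
Proof.
move/eqP/pivotP => [eF emin]; apply/eqP/pivotP; split=> [|a aF].
  by rewrite completes_toggle.
rewrite leqNgt; apply/negP => lt; have := emin a.
by rewrite -(completes_toggle _ _ (ltnW lt)) leqNgt lt => /(_ aF).
Qed.

Definition broken_cycle_free alpha F : bool :=
  acyclic F && [forall e, ~~ completes alpha F e].

(** A compatible set with no broken cycle is a forest: its cycles would have value 0,
    hence contain their own broken cycles. *)
Lemma broken_cycle_freeE alpha F :
  broken_cycle_free alpha F =
    compatible_edges alpha F && (pivot alpha F == None).
Proof.
apply/andP/andP => [[acF /forallP no]|[/forallP cF /pivot_NoneP no]].
  by split; [apply: acyclic_compatible | apply/pivot_NoneP].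
split; last exact/forallP.
apply/forallP => C; apply/negP => sCF; have [e0 e0C] := cycle_has_edge C.
case: (arg_maxnP (fun a => enum_rank a : nat) e0C) => e eC emax.
have /negP := no e; apply; apply/existsP; exists C.
apply/and4P; split=> //; first exact: (implyP (cF C)).
  by apply: subset_trans sCF; apply: subsetDl.
by apply/forall_inP.
Qed.

(** Raising the assigning leaves fewer cycles of value 0, hence fewer broken cycles
    to avoid. *)
Lemma broken_cycle_freeW alpha alpha' F :
  (forall C, (alpha C <= alpha' C)%N) ->
  broken_cycle_free alpha F -> broken_cycle_free alpha' F.
Proof.
move=> le /andP [acF /forallP no]; rewrite /broken_cycle_free acF.
apply/forallP => e; apply: contraNN (no e) => /existsP [C /and4P [zC eC sC mC]].
apply/existsP; exists C; rewrite eC sC mC !andbT.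
by have := le C; rewrite (negPf zC); case: (alpha C).
Qed.

(** * Admissible assignings *)
Section Admissible.
Variables (D : orientation G) (o : gcycle G -> orientation G).
Hypothesis ho : forall C : gcycle G, is_direction C (o C).

(** The only place where admissibility is used. For a cycle [B] of [e |: F], the
    multiple [c] of [C] that cancels [e] turns [B] into a circulation supported in
    [F]. Since all cycles in [F] have sum 0, so has this circulation; and [C] has
    sum 0 too, hence so does [B]. *)
Lemma compatible_edgesU1 alpha F C e :
  admissible D o alpha -> compatible_edges alpha F ->
  ~~ alpha C -> e \in eset (val C) -> eset (val C) :\ e \subset F ->
  compatible_edges alpha (e |: F).
Proof.
move=> [A [f fP]] /forallP cF zC eC sC.
have fE B : ~~ alpha B -> \sum_a f a *~ eta D o B a = 0.
  rewrite fP negbK => /eqP z; rewrite -[RHS]z [RHS]big_mkcond /=.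
  by apply: eq_bigr => a _; rewrite /eta; case: ifP => //; rewrite mulr0z.
have circ := circulation_eta D ho.
apply/forallP => B; apply/implyP => sB; rewrite fP negbK.
pose c := eta D o B e * eta D o C e.
pose x a := eta D o B a - c * eta D o C a.
have x0 : \sum_a f a *~ x a = 0.
  apply: (circulation_orthogonal ho (F := F)) => [p|a|B' sB']; last first.
  - by apply: fE; apply: (implyP (cF B')).
  - have [-> |ae] := eqVneq a e.
      by rewrite /x /c -mulrA eta_sqr // mulr1 subrr eqxx.
    apply: contraNT => aF.
    have aC : eta D o C a == 0.
      rewrite -[_ == 0]negbK eta_neq0; apply: contra aF => aC.
      by apply: (subsetP sC); rewrite !inE ae.
    have aB : eta D o B a == 0.
      rewrite -[_ == 0]negbK eta_neq0; apply: contra aF => aB.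
      by have := subsetP sB a aB; rewrite !inE (negPf ae).
    by rewrite /x (eqP aB) (eqP aC) mulr0 subrr.
  under eq_bigr => a _ do rewrite /x mulrBl -mulrA.
  by rewrite sumrB -mulr_sumr !circ mulr0 subrr.
move/eqP: x0; under eq_bigr => a _ do rewrite /x mulrzBr mulrC mulrzA.
rewrite sumrB -mulrz_suml (fE C zC) mul0rz subr0 => /eqP z; apply/eqP; rewrite -[RHS]z.
rewrite big_mkcond /=; apply: eq_bigr => a _.
by rewrite /eta; case: (a \in eset (val B)); rewrite ?mulr0z.
Qed.

(** Whitney's broken cycle theorem for admissible assignings. Toggling the pivot
    [e] preserves compatibility and the number of components, because the rest of
    a cycle of value 0 through [e] lies in the set throughout. *)
Lemma cycle_assigning_poly_broken_cycle_free alpha :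
  admissible D o alpha ->
  cycle_assigning_poly alpha =
    \sum_(F | broken_cycle_free alpha F) (-1) ^+ #|F| *: 'X^(#|V| - #|F|).
Proof.
move=> adm; rewrite cycle_assigning_poly_edges.
rewrite (toggle_cancel (pivot := pivot alpha)) => [|F e cF pF].
  apply: eq_big => [F|F]; first by rewrite broken_cycle_freeE.
  rewrite -broken_cycle_freeE => /andP [/acyclic_n_comp <- _].
  by rewrite addnK.
have /pivotP [eF _] : pivot alpha F == Some e by apply/eqP.
have /existsP [C /and4P [zC eC sC _]] := eF.
split; last 1 first.
- rewrite sign_toggle scaleNr; congr (- (_ *: 'X^_)).
  have chord F' := @n_comp_adj_chord G F' e.
  rewrite /toggle; case: ifP => eF'; last first.
    by rewrite chord //; apply: (cycle_chord D ho eC sC).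
  rewrite -[in RHS](setD1K eF') chord //.
  by apply: (cycle_chord D ho eC); apply: setSD; rewrite -(setD1K eC) subUset sub1set eF'.
- rewrite /toggle; case: ifP => _; last exact: compatible_edgesU1 sC.
  apply/forallP => B; apply/implyP => sB; apply: (implyP (forallP cF B)).
  by apply: subset_trans sB (subsetDl _ _).
exact: pivot_toggle.
Qed.

(** The sign [(-1) ^+ i] in the coefficient cancels the sign of the sets of size
    [i], the only ones that contribute to the degree [#|V| - i]. *)
Lemma unsigned_coef_broken_cycle_free alpha i :
  admissible D o alpha -> (i <= rank G)%N ->
  unsigned_coef G (cycle_assigning_poly alpha) i =
    #|[set F | broken_cycle_free alpha F & #|F| == i]|%:R.
Proof.
move=> adm ir; rewrite /unsigned_coef cycle_assigning_poly_broken_cycle_free //.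
have iV : (i <= #|V|)%N by apply: leq_trans ir (leq_subr _ _).
rewrite coef_sum mulr_sumr -sum1_card natr_sum.
rewrite (bigID (fun F : {set E} => #|F| == i)) /= [X in _ + X]big1 ?addr0.
  apply: eq_big => [F|F /andP [_ /eqP ->]]; first by rewrite inE.
  by rewrite coefZ coefXn eqxx mulr1 -exprD addnn -mul2n exprM sqrrN !expr1n.
move=> F /andP [/andP [/acyclic_n_comp nF _] Fi].
rewrite coefZ coefXn; case: eqP => [e|_]; last by rewrite !mulr0.
by case/eqP: Fi; rewrite -(subKn iV) e subKn // -nF leq_addl.
Qed.

Lemma unsigned_coef_le alpha alpha' i :
  admissible D o alpha -> admissible D o alpha' ->
  (forall C, (alpha C <= alpha' C)%N) -> (i <= rank G)%N ->
  unsigned_coef G (cycle_assigning_poly alpha) i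
    <= unsigned_coef G (cycle_assigning_poly alpha') i.
Proof.
move=> adm adm' le ir; rewrite !unsigned_coef_broken_cycle_free // ler_nat.
apply: subset_leq_card; apply/subsetP => F; rewrite !inE => /andP [bF ->].
by rewrite (broken_cycle_freeW le).
Qed.

Lemma admissible_zero : admissible D o (zero_assigning G).
Proof.
exists 'Z_2, (fun=> 0) => C; apply/esym/negbTE; rewrite negbK.
by rewrite big1 // => e _; rewrite mul0rz.
Qed.

End Admissible.

(** * The chromatic polynomial *)

(** Inclusion-exclusion over the sets of monochromatic edges: for a fixed coloring
    the signs of the subsets of its monochromatic edges cancel by toggling one
    such edge, unless there is none, that is, unless the coloring is proper. *)
Lemma chromatic_poly_zero_assigning :
  chromatic_poly G = cycle_assigning_poly (zero_assigning G).
Proof.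
apply/esym/chromatic_poly_uniq => k; rewrite cycle_assigning_poly_edges horner_sum.
pose mono (c : {ffun V -> 'I_k}) := [set e | c (ends e).1 == c (ends e).2].
transitivity (\sum_(F : {set E}) \sum_(c : {ffun V -> 'I_k} | F \subset mono c)
    (-1) ^+ #|F| : int).
  apply: eq_big => [F|F _]; first by apply/forallP => C; rewrite implybT.
  rewrite hornerZ hornerXn -natrX -card_component_colorings sumr_const -[RHS]mulr_natr.
  congr (_ * _%:R); apply: eq_card => c; rewrite !inE.
  apply/forall_inP/subsetP => h e /h; by rewrite inE.
rewrite (exchange_big_dep xpredT) //= -sum1_card natr_sum [RHS]big_mkcond /=.
apply: eq_bigr => c _; rewrite inE.
rewrite (toggle_cancel (pivot := fun=> [pick e in mono c])) => [|F e sF]; last first.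
  case: pickP => // b bm [be]; rewrite {b}be in bm *; split=> //.
    rewrite /toggle; case: ifP => _; last by rewrite subUset sub1set bm.
    exact: subset_trans (subsetDl _ _) sF.
  exact: sign_toggle.
case: pickP => [e em|none].
  rewrite big_pred0 => [|F]; last by rewrite andbF.
  by rewrite ifN //; apply/forallPn; exists e; move: em; rewrite inE negbK.
have m0 : mono c = set0 by apply/setP => e; rewrite [LHS]none inE.
rewrite (big_pred1 set0) => [|F]; last by rewrite m0 subset0 andbT.
rewrite cards0 ifT //; apply/forallP => e.
by have := none e; rewrite inE => ->.
Qed.

End BrokenCycles.

(** * Monotonicity of the unsigned coefficients *)

Theorem theorem5p1 (G : mgraph) (D : orientation G)
    (o : gcycle G -> orientation G)
    (ho : forall C : gcycle G, is_direction C (o C)) :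
  (forall alpha alpha' : assigning G,
     admissible D o alpha -> admissible D o alpha' ->
     (forall C : gcycle G, (alpha C <= alpha' C)%N) ->
     forall i : nat, (i <= rank G)%N ->
       unsigned_coef G (cycle_assigning_poly alpha) i
         <= unsigned_coef G (cycle_assigning_poly alpha') i)
  /\ (forall i : nat, (i <= rank G)%N ->
        unsigned_coef G (chromatic_poly G) i
          = unsigned_coef G (cycle_assigning_poly (zero_assigning G)) i
        /\ forall alpha : assigning G, admissible D o alpha ->
             unsigned_coef G (cycle_assigning_poly (zero_assigning G)) i
               <= unsigned_coef G (cycle_assigning_poly alpha) i).
Proof.
split=> [alpha alpha' adm adm' le i|i ir].
  exact: (unsigned_coef_le ho adm adm' le).
split=> [|alpha adm]; first by rewrite chromatic_poly_zero_assigning.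
exact: (unsigned_coef_le ho (admissible_zero D o) adm).
Qed.
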